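(* Let $n\ge 1$. For every $n$-dimensional lattice $L\subset\mathbb{R}^n$ there is a basis $B$ of $L$ which satisfies $$S(B)\le \exp\left(\left(\frac{2}{\ln 2}+1\right)(\ln n)^2+4\ln n\right),$$ where $S(B)$ denotes the Seysen measure of $B$.
   Context: An $n$-dimensional lattice $L\subset\mathbb{R}^n$ is a set $L=\{\sum_{i=1}^n a_i b_i : a_i\in\mathbb{Z}\}$ with $b_1,\dots,b_n\in\mathbb{R}^n$ linearly independent over $\mathbb{R}$. A basis of $L$ is identified with the matrix $B=[b_1|\dots|b_n]^t$ whose rows $b_i$ are linearly independent and generate $L$ over $\mathbb{Z}$. The dual basis is $B^*=(B^{-1})^t=[b_1^*|\dots|b_n^*]^t$, so that $\langle b_i,b_j^*\rangle=\delta_{i,j}$. The Seysen measure of $B$ is $S(B)=\sum_{i=1}^n\|b_i\|^2\,\|b_i^*\|^2$, where $\|\cdot\|$ is the Euclidean norm on vectors. *)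

(* Defs.v *)
From mathcomp Require Import all_boot all_order all_algebra.
From mathcomp Require Import all_classical all_reals all_analysis.

Set Implicit Arguments.
Unset Strict Implicit.
Unset Printing Implicit Defensive.

Import Order.TTheory GRing.Theory Num.Theory.

Local Open Scope classical_set_scope.
Local Open Scope ring_scope.

(* Vectors of R^n are row vectors, and a family b_1, ..., b_n is the matrix   *)
(* whose rows are the b_i.                                                    *)

Definition zspan (R : realType) (n : nat) (B : 'M[R]_n) : set 'rV[R]_n :=
  range (fun a : 'I_n -> int => \sum_i row i B *~ a i).

Definition lattice_basis (R : realType) (n : nat) (L : set 'rV[R]_n)
    (B : 'M[R]_n) : Prop :=
  row_free B /\ L = zspan B.

Definition is_lattice (R : realType) (n : nat) (L : set 'rV[R]_n) : Prop :=
  exists B : 'M[R]_n, lattice_basis L B.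

(* The norm `|v| that MathComp-Analysis puts on matrices is the sup norm,     *)
(* hence a separate Euclidean norm.                                           *)
Definition enorm (R : realType) (n : nat) (v : 'rV[R]_n) : R :=
  Num.sqrt (\sum_j v ord0 j ^+ 2).

Definition dual_basis (R : realType) (n : nat) (B : 'M[R]_n) : 'M[R]_n :=
  (invmx B)^T.

Definition seysen (R : realType) (n : nat) (B : 'M[R]_n) : R :=
  \sum_i enorm (row i B) ^+ 2 * enorm (row i (dual_basis B)) ^+ 2.

(* Main.v *)
Require Import Defs.
From mathcomp Require Import all_boot all_order all_algebra.
From mathcomp Require Import all_classical all_reals all_analysis.
From mathcomp Require Import ring lra zify.

(* Seysen's argument.  Up to an orthogonal change of coordinates, take a basis
   of the form [N D] with [N] lower unitriangular and [D] the diagonal of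
   Gram-Schmidt norms r_1, ..., r_n of an (almost) Hermite-Korkin-Zolotarev
   reduced basis.  Minkowski's theorem with Hermite constant at most m, applied
   to all blocks j..k, gives r_j^2 / r_k^2 <= exp ((ln n)^2 + 3 ln n) for
   j <= k.  A unimodular [U], built by recursively halving the dimension, makes
   the entries of [W = U N] and of [W^-1] at most M, where
   M^4 <= exp (2 (ln n)^2 / ln 2 - 2 ln n).  Finally S (W D) is the sum over
   j <= i <= k of W_ij^2 (W^-1)_ki^2 r_j^2 / r_k^2, which has at most n^3 terms. *)

Set Implicit Arguments.
Unset Strict Implicit.

Import Order.TTheory GRing.Theory Num.Theory.

Local Open Scope classical_set_scope.
Local Open Scope ring_scope.

Local Notation toR A := (map_mx intr A).

(** * Squared Euclidean norm and reflections *)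

Definition sqn {R : realType} {n : nat} (v : 'rV[R]_n) : R := \sum_j v ord0 j ^+ 2.

Lemma sqn_ge0 {R : realType} {n} (v : 'rV[R]_n) : 0 <= sqn v.
Proof. by apply: sumr_ge0 => j _; rewrite sqr_ge0. Qed.

Lemma sqn_eq0 {R : realType} {n} (v : 'rV[R]_n) : (sqn v == 0) = (v == 0).
Proof.
apply/idP/eqP => [|->]; last by rewrite /sqn big1 // => j _; rewrite mxE expr0n.
rewrite psumr_eq0 => [/allP h|j _]; last by rewrite sqr_ge0.
apply/rowP => j; rewrite mxE; apply/eqP.
by have := h j; rewrite mem_index_enum sqrf_eq0 => /(_ isT).
Qed.

Lemma enorm_sqr {R : realType} {n} (v : 'rV[R]_n) : enorm v ^+ 2 = sqn v.
Proof. exact/sqr_sqrtr/sqn_ge0. Qed.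

Lemma mul_tr_row {R : realType} {n} (v : 'rV[R]_n) : v *m v^T = (sqn v)%:M.
Proof.
rewrite [LHS]mx11_scalar mxE; congr (_%:M).
by apply: eq_bigr => j _; rewrite mxE expr2.
Qed.

Lemma sqn_mulmx_orth {R : realType} {n} (v : 'rV[R]_n) (Q : 'M[R]_n) :
  Q *m Q^T = 1%:M -> sqn (v *m Q) = sqn v.
Proof.
move=> QQ; have := mul_tr_row (v *m Q).
rewrite trmx_mul mulmxA -(mulmxA v) QQ mulmx1 mul_tr_row.
by move=> /(congr1 (fun M : 'M[R]_1 => M 0 0)); rewrite !mxE.
Qed.

Lemma sqn_row_mx {R : realType} {m n} (u : 'rV[R]_m) (v : 'rV[R]_n) :
  sqn (row_mx u v) = sqn u + sqn v.
Proof.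
rewrite /sqn big_split_ord /=; congr (_ + _); apply: eq_bigr => j _.
  by rewrite row_mxEl.
by rewrite row_mxEr.
Qed.

Lemma sqn0 {R : realType} {n} : sqn (0 : 'rV[R]_n) = 0.
Proof. by apply/eqP; rewrite sqn_eq0. Qed.

Lemma sqnZ {R : realType} {n} c (v : 'rV[R]_n) : sqn (c *: v) = c ^+ 2 * sqn v.
Proof. by rewrite /sqn mulr_sumr; apply: eq_bigr => j _; rewrite mxE exprMn. Qed.

(* The Householder reflection in the hyperplane orthogonal to [u - v]. *)
Lemma householder {R : realType} {n} (u v : 'rV[R]_n) : sqn u = sqn v ->
  exists2 Q : 'M[R]_n, Q *m Q^T = 1%:M & u *m Q = v.
Proof.
move=> uv; have [->|neq] := eqVneq u v.
  by exists 1%:M; rewrite ?trmx1 ?mulmx1.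
pose w := u - v; have s0 : sqn w != 0 by rewrite sqn_eq0 subr_eq0.
pose P := w^T *m w.
(* As [u] and [v] have equal length, the inner product of [u] with [w] is half of [sqn w], so
   reflecting [u] subtracts exactly [w]. *)
have uw : u *m w^T = (sqn w / 2)%:M.
  have vu : v *m u^T = u *m v^T.
    rewrite -[LHS]trmxK trmx_mul trmxK [RHS]mx11_scalar.
    by rewrite [X in X^T]mx11_scalar tr_scalar_mx.
  have e : sqn w = 2 * (u *m w^T) 0 0.
    have uE : u *m w^T = (sqn u)%:M - u *m v^T by rewrite linearB /= mulmxBr mul_tr_row.
    have vE : v *m w^T = u *m v^T - (sqn v)%:M.
      by rewrite linearB /= mulmxBr mul_tr_row vu.
    have wE : w *m w^T = u *m w^T - v *m w^T by rewrite -mulmxBl.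
    have := mul_tr_row w; rewrite wE vE.
    move=> /(congr1 (fun M : 'M[R]_1 => M 0 0)).
    rewrite uE uv !mxE !eqxx !mulr1n => <-; ring.
  by rewrite [LHS]mx11_scalar e mulrC mulKf // pnatr_eq0.
have PP : P *m P = sqn w *: P.
  by rewrite /P mulmxA -(mulmxA _ w) mul_tr_row mul_mx_scalar -scalemxAl.
have PT : P^T = P by rewrite /P trmx_mul trmxK.
exists (1%:M - (2 / sqn w) *: P).
  have -> : (1%:M - (2 / sqn w) *: P)^T = 1%:M - (2 / sqn w) *: P.
    by rewrite linearB /= linearZ /= trmx1 PT.
  have cPcP : ((2 / sqn w) *: P) *m ((2 / sqn w) *: P) =
      (2 / sqn w) *: P + (2 / sqn w) *: P.
    by rewrite -scalemxAl -scalemxAr PP !scalerA -scalerDl; congr (_ *: _); field.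
  by rewrite mulmxBl mul1mx mulmxBr mulmx1 cPcP opprB addrK subrK.
rewrite mulmxBr mulmx1 -scalemxAr mulmxA uw mul_scalar_mx scalerA.
by rewrite (_ : _ * _ = 1) ?scale1r ?subKr //; field.
Qed.

(** * Unimodular and orthogonal changes of a basis *)

Lemma toR_unitmx {R : realType} {n} (U : 'M[int]_n) :
  U \in unitmx -> (toR U : 'M[R]_n) \in unitmx.
Proof.
move=> uU; suff : (toR U : 'M[R]_n) *m toR (invmx U) = 1%:M by case/mulmx1_unit.
by rewrite -map_mxM mulmxV // map_mx1.
Qed.

Lemma zspanE {R : realType} {n} (B : 'M[R]_n) :
  zspan B = range (fun x : 'rV[int]_n => toR x *m B).
Proof.
have E (a : 'I_n -> int) : \sum_i row i B *~ a i = toR (\row_i a i) *m B.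
  by rewrite mulmx_sum_row; apply: eq_bigr => i _; rewrite !mxE scaler_int.
apply/seteqP; split=> _ [a _ <-]; first by exists (\row_i a i); rewrite // E.
exists (fun i => a ord0 i) => //; rewrite E; congr (toR _ *m _).
by apply/rowP => i; rewrite mxE.
Qed.

Lemma zspan_unimodular {R : realType} {n} (U : 'M[int]_n) (B : 'M[R]_n) :
  U \in unitmx -> zspan (toR U *m B) = zspan B.
Proof.
move=> uU; rewrite !zspanE; apply/seteqP; split=> _ [x _ <-].
  by exists (x *m U); rewrite // map_mxM mulmxA.
exists (x *m invmx U) => //.
by rewrite mulmxA -map_mxM mulmxKV.
Qed.

Lemma invmx_eq {F : comUnitRingType} {n} (A B : 'M[F]_n) : A *m B = 1%:M -> invmx A = B.
Proof. by move=> AB; rewrite -[RHS](mulKmx (proj1 (mulmx1_unit AB))) AB mulmx1. Qed.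

(** The inverse of [Q] is its transpose, so the dual basis of [B Q] is that of [B] multiplied by the
    same [Q]. *)
Lemma seysen_orth {R : realType} {n} (B Q : 'M[R]_n) :
  B \in unitmx -> Q *m Q^T = 1%:M -> seysen (B *m Q) = seysen B.
Proof.
move=> uB QQ.
have iBQ : invmx (B *m Q) = Q^T *m invmx B.
  by apply: invmx_eq; rewrite mulmxA -(mulmxA B) QQ mulmx1 mulmxV.
apply: eq_bigr => i _; rewrite !enorm_sqr row_mul sqn_mulmx_orth //; congr (_ * _).
rewrite /dual_basis iBQ trmx_mul trmxK row_mul.
by rewrite sqn_mulmx_orth.
Qed.

(** * Almost shortest lattice vectors *)

(** A nonzero integer vector has an entry of absolute value at least 1, and [y] is recovered from
    [y B] through the inverse of [B], whose size [K] bounds; hence [y B] cannot be too short. *)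
Lemma sqn_lattice_lb {R : realType} {n} (B : 'M[R]_n) : B \in unitmx ->
  exists2 e : R, 0 < e & forall y : 'rV[int]_n, y != 0 -> e <= sqn (toR y *m B).
Proof.
move=> uB; pose K : R := 1 + \sum_i \sum_j `|invmx B j i|.
have K0 : 0 < K by rewrite ltr_pwDl // !sumr_ge0 // => i _; rewrite sumr_ge0.
exists (K ^- 2) => [|y]; first by rewrite invr_gt0 exprn_gt0.
set x := toR y *m B => /rV0Pn[i yi].
have yE : toR y = x *m invmx B by rewrite mulmxK.
have ub j : `|x 0 j| <= Num.sqrt (sqn x).
  rewrite -sqrtr_sqr ler_sqrt ?sqn_ge0 // /sqn (bigD1 j) //= lerDl.
  by apply: sumr_ge0 => k _; rewrite sqr_ge0.
have le1 : 1 <= Num.sqrt (sqn x) * K.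
  have y1 : 1 <= `|(toR y : 'rV[R]_n) 0 i|.
    by rewrite mxE -intr_norm ler1z -gtz0_ge1 normr_gt0.
  apply: (le_trans y1); rewrite yE mxE.
  apply: (le_trans (ler_norm_sum _ _ _)).
  apply: (@le_trans _ _ (\sum_j Num.sqrt (sqn x) * `|invmx B j i|)).
    by apply: ler_sum => j _; rewrite normrM ler_wpM2r.
  rewrite -mulr_sumr ler_wpM2l ?sqrtr_ge0 //.
  rewrite /K [X in _ <= 1 + X](bigD1 i) //= addrCA lerDl.
  by rewrite addr_ge0 // sumr_ge0 // => k _; rewrite sumr_ge0.
rewrite -[leRHS]sqr_sqrtr ?sqn_ge0 // -exprVn lerXn2r ?nnegrE ?sqrtr_ge0 //.
  by rewrite invr_ge0 ltW.
by rewrite -[leLHS]mul1r ler_pdivrMr.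
Qed.

(* The factor [c] spares us the discreteness argument for an exact minimum. *)
Lemma almost_shortest {R : realType} {n} (B : 'M[R]_n.+1) (c : R) :
  B \in unitmx -> 1 < c ->
  exists2 x : 'rV[int]_n.+1, x != 0 & forall y : 'rV[int]_n.+1, y != 0 ->
    sqn (toR x *m B) <= c * sqn (toR y *m B).
Proof.
move=> uB c1; have [e e0 eP] := sqn_lattice_lb uB.
pose E : set R := [set sqn (toR y *m B) | y in [set y : 'rV[int]_n.+1 | y != 0]].
have E0 : E !=set0.
  exists (sqn (toR (const_mx 1 : 'rV[int]_n.+1) *m B)), (const_mx 1) => //=.
  by apply/rV0Pn; exists 0; rewrite mxE.
have lbE : lbound E e by move=> _ [y /= y0 <-]; exact: eP.
have hE : has_inf E by split=> //; exists e.
have i0 : 0 < inf E by apply: (lt_le_trans e0); apply: lb_le_inf.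
(* The infimum is positive, so [c] times it leaves room for an element of [E]. *)
have d0 : 0 < (c - 1) * inf E by rewrite mulr_gt0 // subr_gt0.
have [_ [x /= x0 <-] xlt] := inf_adherent d0 hE.
exists x => // y y0; apply: (le_trans (ltW xlt)).
rewrite mulrBl mul1r addrC subrK ler_wpM2l ?(le_trans _ (ltW c1)) //.
by apply: ge_inf; [exists e | exists y].
Qed.

(* Via the Smith normal form, [x] is an integer multiple of the first row of a
   unimodular matrix, so that row is at least as short as [x]. *)
Lemma almost_shortest_row {R : realType} {n} (B : 'M[R]_n.+1) (c : R) :
  B \in unitmx -> 1 < c ->
  exists2 U : 'M[int]_n.+1, U \in unitmx & forall y : 'rV[int]_n.+1, y != 0 ->
    sqn (row 0 (toR U *m B)) <= c * sqn (toR y *m B).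
Proof.
move=> uB c1; have [x x0 xP] := almost_shortest uB c1.
have [K uK [U uU [d _ xE]]] := int_Smith_normal_form x.
exists U => // y y0; apply: le_trans (xP y y0).
pose a : int := K 0 0 * d`_0.
have {}xE : x = a *: row 0 U.
  rewrite xE [K]mx11_scalar -mulmxA mul_scalar_mx -scalerA; congr (_ *: _).
  apply/rowP => j; rewrite !mxE big_ord_recl big1 => [|i _].
    by rewrite !mxE eqxx mulr1n addr0.
  by rewrite mxE mulr0n mul0r.
have a0 : a != 0 by apply: contraNneq x0 => a0; rewrite xE a0 scale0r.
have -> : toR x *m B = a%:~R *: row 0 (toR U *m B).
  by rewrite xE row_mul scalemxAl; congr (_ *m _); apply/rowP => j; rewrite !mxE rmorphM.
rewrite sqnZ ler_peMl ?sqn_ge0 // -rmorphXn /= ler1z -gtz0_ge1.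
by rewrite lt_neqAle sqr_ge0 eq_sym sqrf_eq0 a0.
Qed.

(** * Minkowski's theorem for cubes *)

(* The boxes spanned by the Gram-Schmidt vectors tile the space along the
   lattice (Babai's nearest plane algorithm). *)
Lemma lattice_box_tiling {R : realType} {n} (T : 'M[R]_n) :
  is_trig_mx T -> (forall i, 0 < T i i) ->
  forall y : 'rV[R]_n, exists x : 'rV[int]_n,
    forall j, y 0 j <= (toR x *m T) 0 j < y 0 j + T j j.
Proof.
move: n T; apply: trigsqmx_ind => [_ y|n r c T trT IH posT y].
  by exists 0 => -[].
have posT' i : 0 < T i i.
  by have := posT (rshift 1 i); rewrite block_mxEdr.
have r0 : 0 < r 0 0 by have := posT (lshift n ord0); rewrite block_mxEul.
have [x xP] := IH posT' (rsubmx y).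
pose z := (toR x *m c) 0 0.
(* The coefficient [k] of the first row affects only the first coordinate, whose target interval has
   length [r 0 0]; rounding up hits it. *)
pose k : int := Num.ceil ((y 0 (lshift n ord0) - z) / r 0 0).
exists (row_mx k%:M x) => j.
rewrite map_row_mx mul_row_block mulmx0 add0r.
case: (split_ordP j) => {}j ->; last first.
  by rewrite row_mxEr block_mxEdr; have := xP j; rewrite mxE.
have -> : j = 0 by exact: ord1.
rewrite row_mxEl block_mxEul mxE -/z.
have -> : (toR k%:M *m r) 0 0 = k%:~R * r 0 0.
  by rewrite mxE big_ord1 !mxE eqxx mulr1n.
have kl : (y 0 (lshift n ord0) - z) / r 0 0 <= k%:~R by exact: ceil_ge.
have kr : k%:~R < (y 0 (lshift n ord0) - z) / r 0 0 + 1.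
  rewrite -ltrBlDr; have := @ceilB1_lt R ((y 0 (lshift n ord0) - z) / r 0 0).
  by rewrite intrD.
move: kl kr; rewrite ler_pdivrMr // -ltrBlDr ltr_pdivlMr // => kl kr.
apply/andP; split; nra.
Qed.

(** Stated for dependent tuples because the number [N j] of boxes varies with the axis [j]. *)
Lemma pigeonhole_prod {n : nat} (N : 'I_n -> nat) (M : nat)
    (f : (forall j, 'I_(N j)) -> 'I_n -> 'I_M) :
  (M ^ n < \prod_j N j)%N ->
  exists k l : forall j, 'I_(N j), (exists j, k j <> l j) /\ f k =1 f l.
Proof.
move=> MN; pose F (k : {dffun forall j, 'I_(N j)}) : {ffun 'I_n -> 'I_M} :=
  [ffun j => f (fun i => k i) j].
have [/injectiveP injF|/injectivePn[k [l kl Fkl]]] := boolP (injectiveb F).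
  have := leq_card F injF; rewrite card_ffun !card_ord card_dep_ffun.
  rewrite foldrE big_map big_enum /= (eq_bigr N) => [|j _]; last by rewrite card_ord.
  by rewrite leqNgt MN.
exists (fun j => k j), (fun j => l j); split; last first.
  by move=> j; have /ffunP/(_ j) := Fkl; rewrite !ffunE.
apply/existsNP => kl'; move/eqP: kl; apply; apply/ffunP => j; exact: kl'.
Qed.

(** Proved by counting: a cube of side [t * g * M.+1] contains more lattice points than it has cells
    of side [t * g]. Two of them share a cell, and their difference is the required vector. *)
Lemma minkowski_box {R : realType} {n} (T : 'M[R]_n.+1) (t g : R) :
  is_trig_mx T -> (forall i, 0 < T i i) -> 0 < g -> 1 < t ->
  g ^+ n.+1 = \prod_i T i i ->
  exists2 x : 'rV[int]_n.+1, x != 0 & forall j, `|(toR x *m T) 0 j| < t * g.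
Proof.
move=> trT posT g0 t1 gT.
have t0 : 0 < t by apply: lt_trans t1.
have s0 : 0 < t * g by rewrite mulr_gt0.
have tg0 : 0 < (t - 1) * g by rewrite mulr_gt0 // subr_gt0.
(* Large enough that each [T i i] is at most [(t - 1) * g * M.+1]: the loss from rounding down in
   [N] is then absorbed by the factor [t]. *)
pose M := Num.bound (\sum_i T i i / ((t - 1) * g)).
have MT i : T i i <= (t - 1) * g * M.+1%:R.
  rewrite -ler_pdivrMl // mulrC.
  have S0 : 0 <= \sum_i T i i / ((t - 1) * g).
    by apply: sumr_ge0 => j _; rewrite divr_ge0 // ltW.
  apply: (@le_trans _ _ (\sum_i T i i / ((t - 1) * g))); last first.
    by rewrite (le_trans (ltW (archi_boundP S0))) // ler_nat.
  rewrite (bigD1 i) //= lerDl; apply: sumr_ge0 => j _; by rewrite divr_ge0 // ltW.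
(* This many tiling boxes fit side by side along axis [i] of the large cube. *)
pose N i := `|Num.floor (t * g * M.+1%:R / T i i)|%N.
have NE i : (N i)%:R = (Num.floor (t * g * M.+1%:R / T i i))%:~R :> R.
  rewrite natr_absz ger0_norm // floor_ge0.
  by rewrite divr_ge0 ?ltW // mulr_gt0.
have NT i : (N i)%:R * T i i <= t * g * M.+1%:R.
  by rewrite -ler_pdivlMr // NE floor_le.
have NG i : g * M.+1%:R / T i i < (N i)%:R.
  have := floorD1_gt (t * g * M.+1%:R / T i i); rewrite intrD -NE -ltrBlDr.
  apply: le_lt_trans; rewrite ler_pdivrMr // mulrBl divfK ?gt_eqF // mul1r.
  by have := MT i; lra.
have MN : (M.+1 ^ n.+1 < \prod_j N j)%N.
  rewrite -(ltr_nat R) natr_prod natrX.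
  have -> : M.+1%:R ^+ n.+1 = \prod_i (g * M.+1%:R / T i i) :> R.
    rewrite !big_split /= prodfV !prodr_const card_ord gT mulrC mulrA mulVf ?mul1r //.
    by apply/prodf_neq0 => i _; rewrite gt_eqF.
  apply: ltr_prod => [|i _]; first by apply/hasP; exists ord0; rewrite ?mem_index_enum.
  by rewrite NG andbT divr_ge0 ?ltW // mulr_gt0.
have /choice[x xP] := lattice_box_tiling trT posT.
pose X (k : forall j, 'I_(N j)) := x (\row_j ((k j)%:R * T j j)).
pose p k := toR (X k) *m T.
have pl (k : forall j, 'I_(N j)) j : (k j)%:R * T j j <= p k 0 j.
  by have /andP[+ _] := xP (\row_j ((k j)%:R * T j j)) j; rewrite mxE.
have pr (k : forall j, 'I_(N j)) j : p k 0 j < (k j).+1%:R * T j j.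
  have /andP[_] := xP (\row_j ((k j)%:R * T j j)) j; rewrite [X in X + _]mxE.
  by rewrite -{2}[T j j]mul1r -mulrDl natr1.
have p_ge0 (k : forall j, 'I_(N j)) j : 0 <= p k 0 j.
  by apply: le_trans (pl k j); rewrite mulr_ge0 // ltW.
have pM k j : p k 0 j < t * g * M.+1%:R.
  apply: lt_le_trans (pr k j) (le_trans _ (NT j)).
  by rewrite ler_pM2r // ler_nat.
(* The coordinates of the cell that contains the lattice point [p k]. *)
pose c k j := Num.floor (p k 0 j / (t * g)).
have c0 k j : 0 <= c k j by rewrite floor_ge0 divr_ge0 // ltW.
have cM k j : (`|c k j| < M.+1)%N.
  rewrite -ltz_nat gez0_abs // floor_lt_int ltr_pdivrMr //.
  by rewrite mulrC; exact: pM.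
have [k [l [[i kl] ckl]]] := pigeonhole_prod (fun k j => Ordinal (cM k j)) MN.
have {}ckl j : c k j = c l j.
  have /(congr1 val)/= := ckl j.
  by rewrite -{2}[c k j]gez0_abs // -{2}[c l j]gez0_abs // => ->.
exists (X k - X l) => [|j].
  (* Distinct boxes hold distinct lattice points: on the axis [i] their coordinates lie in disjoint
     intervals. *)
  rewrite subr_eq0; apply/eqP => XE; apply: kl; apply/val_inj => /=.
  have pE : p k = p l by rewrite /p XE.
  have := pr l i; rewrite -pE => /(le_lt_trans (pl k i)).
  have := pr k i; rewrite pE => /(le_lt_trans (pl l i)).
  by rewrite !ltr_pM2r // !ltr_nat; lia.
have -> : (toR (X k - X l) *m T) 0 j = p k 0 j - p l 0 j.
  by rewrite map_mxB mulmxBl !mxE.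
have /andP[k1 k2] := floor_itv (p k 0 j / (t * g)).
have /andP[l1 l2] := floor_itv (p l 0 j / (t * g)).
move: k1 k2 l1 l2; rewrite -/(c k j) -/(c l j) ckl intrD.
rewrite !ler_pdivlMr // !ltr_pdivrMr // => k1 k2 l1 l2.
rewrite ltr_norml; apply/andP; split; nra.
Qed.

(** As [T] is lower triangular, its first [m.+1] rows live in the first [m.+1] coordinates. There
    the cube theorem gives entries below [t] times the geometric mean of the diagonal, and adding
    [m.+1] squares produces the Hermite constant [m.+1]. *)
Lemma short_prefix_vector {R : realType} {n m} (T : 'M[R]_n) (a : nat -> R) (t : R) :
  is_trig_mx T -> (forall i : 'I_n, T i i = expR (a i)) -> 1 < t -> (m < n)%N ->
  exists2 x : 'rV[int]_n, x != 0 & sqn (toR x *m T) <=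
    t ^+ 2 * m.+1%:R * expR (2 / m.+1%:R * \sum_(i < m.+1) a i).
Proof.
move=> trT Ta t1 mn.
have [p pE] : exists p, n = (m.+1 + p)%N by exists (n - m.+1)%N; rewrite subnKC.
move: T trT Ta; rewrite {n mn}pE => T trT Ta.
pose g := expR ((\sum_(i < m.+1) a i) / m.+1%:R).
have Tul i : ulsubmx T i i = expR (a i) by rewrite !mxE Ta.
have [i||x x0 xP] := minkowski_box (ulsubmx_trig trT) _ (expR_gt0 _ : 0 < g) t1.
- by rewrite Tul expR_gt0.
- rewrite -expRM_natr divfK ?pnatr_eq0 // expR_sum.
  by apply: eq_bigr => i _; rewrite Tul.
exists (row_mx x 0).
  by apply: contraNneq x0 => /(congr1 lsubmx); rewrite row_mxKl linear0 => ->.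
rewrite map_row_mx map_mx0 -[T]submxK mul_row_block !mul0mx !addr0.
rewrite (ursubmx_trig (leqnn _) trT) mulmx0 sqn_row_mx sqn0 addr0.
have -> : t ^+ 2 * m.+1%:R * expR (2 / m.+1%:R * \sum_(i < m.+1) a i) =
    \sum_(i < m.+1) (t * g) ^+ 2.
  rewrite sumr_const card_ord exprMn /g -expRM_natr -[RHS]mulr_natr [LHS]mulrAC.
  by congr (_ * expR _ * _); ring.
apply: ler_sum => j _; rewrite -real_normK ?num_real //.
by rewrite lerXn2r ?nnegrE ?normr_ge0 ?ltW // mulr_gt0 ?expR_gt0 // (lt_trans ltr01).
Qed.

(** * Almost Hermite-Korkin-Zolotarev reduction *)

(* The inequalities on the diagonal of [U B Q] are those satisfied by the
   Gram-Schmidt norms of a Hermite-Korkin-Zolotarev basis, up to [c * t ^+ 2]. *)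
Lemma almost_hkz {R : realType} (c t : R) {n} (B : 'M[R]_n) :
  1 < c -> 1 < t -> B \in unitmx ->
  exists (U : 'M[int]_n) (Q : 'M[R]_n) (a : nat -> R),
    [/\ U \in unitmx, Q *m Q^T = 1%:M, is_trig_mx (toR U *m B *m Q),
        forall i : 'I_n, (toR U *m B *m Q) i i = expR (a i) &
        forall j m, (j + m < n)%N ->
          expR (2 * a j) <= c * (t ^+ 2 * m.+1%:R *
            expR (2 / m.+1%:R * \sum_(i < m.+1) a (j + i)%N))].
Proof.
move=> c1 t1; elim: n B => [|n IH] B uB.
  exists 1%:M, 1%:M, (fun=> 0); split=> //; first exact: unitmx1.
  - by rewrite trmx1 mulmx1.
  - by apply/is_trig_mxP => -[].
  - by case.
have [V uV VP] := almost_shortest_row uB c1.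
pose v := row 0 (toR V *m B); pose r := Num.sqrt (sqn v).
have uVB : toR V *m B \in unitmx by rewrite unitmx_mul toR_unitmx.
(* Reflect the first row onto the first axis. The block [drsubmx C] is then a basis of the lattice
   projected orthogonally to that row. *)
have [|H HH vH] := @householder _ (1 + n) v (row_mx r%:M 0).
  by rewrite sqn_row_mx sqn0 addr0 {2}/sqn big_ord1 mxE eqxx mulr1n sqr_sqrtr // sqn_ge0.
have [C CV] : exists C : 'M[R]_(1 + n), C = toR V *m B *m H by exists (toR V *m B *m H).
have uC : C \in unitmx by rewrite CV unitmx_mul uVB; case: (mulmx1_unit HH).
have CE : C = block_mx r%:M 0 (dlsubmx C) (drsubmx C).
  have rC : row 0 C = row_mx r%:M 0 by rewrite CV row_mul.
  have l0 : lshift n (0 : 'I_1) = 0 :> 'I_(1 + n) by apply/val_inj.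
  have C0 k : C (lshift n 0) k = row_mx r%:M 0 0 k by rewrite -rC mxE l0.
  rewrite -[LHS]submxK; congr block_mx; apply/rowP => j; rewrite 2!mxE C0.
    by rewrite row_mxEl.
  by rewrite row_mxEr mxE.
have : \det C != 0 by rewrite -unitfE -unitmxE.
rewrite CE det_lblock mulf_eq0 negb_or det_scalar1 => /andP[r0 dC].
have {}r0 : 0 < r by rewrite lt_neqAle eq_sym r0 sqrtr_ge0.
have [|U [Q [a [uU QQ trT Ta Tle]]]] := IH (drsubmx C).
  by rewrite unitmxE unitfE.
pose U1 : 'M[int]_(1 + n) := block_mx 1%:M 0 0 U.
pose Q1 : 'M[R]_(1 + n) := block_mx 1%:M 0 0 Q.
have uU1 : U1 \in unitmx by rewrite unitmxE det_lblock det1 mul1r -unitmxE.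
pose a1 i := if i is i'.+1 then a i' else ln r.
have TE : toR (U1 *m V) *m B *m (H *m Q1) =
    block_mx r%:M 0 (toR U *m dlsubmx C) (toR U *m drsubmx C *m Q).
  rewrite map_mxM !mulmxA -(mulmxA (toR U1)) -(mulmxA (toR U1)) -CV [in LHS]CE.
  rewrite map_block_mx !map_mx0 map_mx1 !mulmx_block.
  by rewrite !mulmx0 !mul0mx !mulmx1 !mul1mx !addr0 !add0r mul0mx.
have T1tr : is_trig_mx (toR (U1 *m V) *m B *m (H *m Q1)).
  by rewrite TE is_trig_block_mx // eqxx scalar_mx_is_trig trT.
have T1a i : (toR (U1 *m V) *m B *m (H *m Q1)) i i = expR (a1 i).
  rewrite TE; case: (split_ordP i) => {}i ->.
    by rewrite block_mxEul (ord1 i) mxE eqxx mulr1n /= lnK.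
  by rewrite block_mxEdr Ta.
have uUV : U1 *m V \in unitmx by rewrite unitmx_mul uU1.
have H1 : (H *m Q1) *m (H *m Q1)^T = 1%:M.
  have Q1T : Q1 *m Q1^T = 1%:M.
    rewrite /Q1 tr_block_mx !trmx0 trmx1 mulmx_block QQ.
    by rewrite !mulmx0 !mul0mx !mulmx1 !addr0 !add0r -scalar_mx_block.
  by rewrite trmx_mul mulmxA -(mulmxA H) Q1T mulmx1.
(* Blocks starting after the first row are covered by induction. For those starting at it,
   Minkowski's vector competes with the almost shortest first row. *)
exists (U1 *m V), (H *m Q1), a1; split=> // -[|j] m jm; last exact: Tle.
have [x x0 xle] := short_prefix_vector T1tr T1a t1 jm.
rewrite expRM_natl lnK // sqr_sqrtr ?sqn_ge0 //.
have y0 : x *m (U1 *m V) != 0.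
  by apply: contraNneq x0 => xU; rewrite -(mulmxK uUV x) xU mul0mx.
apply: le_trans (VP _ y0) _; rewrite ler_pM2l ?(lt_trans _ c1) //.
apply: le_trans xle; rewrite le_eqVlt; apply/orP; left; apply/eqP; symmetry.
by rewrite mulmxA (sqn_mulmx_orth _ H1) mulmxA -map_mxM.
Qed.

(** * Ratios of Gram-Schmidt norms *)

(** The hypothesis says that [b j] exceeds the mean of its block by at most [L], so dropping it from
    [m.+2] terms lowers the mean by at most [L m.+2 / m.+1]. Repeat until only the last term is
    left. *)
Lemma mean_le_last {R : realType} (L b : nat -> R) n :
  (forall j m, (j + m < n)%N ->
    b j <= L m.+1 + (\sum_(i < m.+1) b (j + i)%N) / m.+1%:R) ->
  forall m j, (j + m < n)%N ->
    (\sum_(i < m.+1) b (j + i)%N) / m.+1%:R <=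
    b (j + m)%N + \sum_(i < m) L i.+2 / i.+1%:R.
Proof.
move=> hb; elim=> [|m IH] j jm.
  by rewrite big_ord1 big_ord0 addn0 addr0 divr1.
have := hb j m.+1 jm; rewrite big_ord_recl addn0 /=.
have jm' : (j.+1 + m < n)%N by rewrite addSnnS.
have := IH j.+1 jm'; rewrite addSnnS [X in _ -> _ -> _ <= _ + X]big_ord_recr /=.
rewrite (eq_bigr (fun i : 'I_m.+1 => b (j + bump 0 i)%N)) => [|i _]; last first.
  by congr b; rewrite /bump /=; lia.
set S := \sum_(i < m.+1) _; set E := \sum_(i < m) _.
set x := L m.+2; set y := b j; set z := b _ => h1 h2.
have p1 : 0 < m.+1%:R :> R by rewrite ltr0n.
have p2 : 0 < m.+2%:R :> R by rewrite ltr0n.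
have e2 : m.+2%:R = m.+1%:R + 1 :> R by rewrite -natr1.
apply: (@le_trans _ _ (S / m.+1%:R + x / m.+1%:R)); last by rewrite addrA lerD2r.
rewrite -mulrDl ler_pdivlMr // mulrAC ler_pdivrMr //.
move: h2; rewrite -lerBlDr -(ler_pM2r p2) mulrBl divfK ?gt_eqF // e2.
by nra.
Qed.

(** A discrete derivative of [ln], from [ln (1 - y) <= - y] at [y = 1 / N.+1]. *)
Lemma ln_succ_lb {R : realType} (N : nat) : (0 < N)%N ->
  1 <= N.+1%:R * (ln N.+1%:R - ln N%:R) :> R.
Proof.
move=> N0; have p1 : 0 < N.+1%:R :> R by rewrite ltr0n.
have p0 : 0 < N%:R :> R by rewrite ltr0n.
have lt1 : N.+1%:R^-1 < 1 :> R by rewrite invf_lt1 // ltr1n.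
have := @le_ln1Dx R (- N.+1%:R^-1); rewrite ltrN2 => /(_ lt1).
have -> : 1 - N.+1%:R^-1 = N%:R / N.+1%:R :> R.
  by rewrite -natr1; field; rewrite natr1 gt_eqF.
rewrite ln_div ?posrE // lerNr opprB => h.
by rewrite mulrC -ler_pdivrMr // mul1r.
Qed.

(** By induction, each new term of the sum is at most the increment of [ln ^+ 2 + 2 * ln]. The bound
    on [C] gives [ln C <= ln 2 / 2], which the linear terms absorb. *)
Lemma hkz_constant_le {R : realType} (C : R) (m : nat) :
  1 <= C -> C ^+ 2 <= 2 ->
  ln (C * m.+2%:R) + \sum_(i < m.+1) ln (C * i.+2%:R) / i.+1%:R <=
  ln m.+2%:R ^+ 2 + 3 * ln m.+2%:R.
Proof.
move=> C1 C2; have C0 : 0 < C by apply: lt_le_trans C1.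
have lC : 2 * ln C <= ln 2.
  by rewrite mulrC mulr_natr -lnXn // ler_ln ?posrE ?exprn_gt0.
have l2 : ln 2 <= 1 :> R by have := @le_ln1Dx R 1; rewrite -[1 + 1]/2; apply; lra.
have lM (i : nat) : ln (C * i.+1%:R) = ln C + ln i.+1%:R by rewrite lnM // posrE ltr0n.
suff : \sum_(i < m.+1) ln (C * i.+2%:R) / i.+1%:R <=
    ln m.+2%:R ^+ 2 + 2 * ln m.+2%:R - ln C by rewrite lM; lra.
elim: m => [|m IH].
  by rewrite big_ord1 divr1 lM; have := sqr_ge0 (ln 2 : R); lra.
rewrite big_ord_recr /=; move: IH; set E := \sum_(i < m.+1) _ => IH.
set N := m.+2 in IH *; rewrite lM.
have N2 : 2 <= N%:R :> R by rewrite ler_nat.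
have NE : N.+1%:R = N%:R + 1 :> R by rewrite natr1.
have v0 : 0 <= ln N%:R :> R by rewrite ln_ge0 // ler1n.
have u2v : ln N.+1%:R <= 2 * ln N%:R :> R.
  rewrite mulrC mulr_natr -lnXn ?ltr0n // ler_ln ?posrE ?exprn_gt0 ?ltr0n //.
  by rewrite NE; move: N2; move: (N%:R) => x x2; nra.
have d1 : 1 <= (N%:R + 1) * (ln N.+1%:R - ln N%:R) :> R.
  by rewrite -NE; exact: ln_succ_lb.
have l0 : 0 <= ln C by exact: ln_ge0.
have uv0 : 0 <= ln N.+1%:R - ln N%:R :> R.
  by rewrite subr_ge0 ler_ln ?posrE ?ltr0n // ler_nat.
move: IH u2v v0 uv0 d1.
set u := ln N.+1%:R; set v := ln N%:R; set x := N%:R in N2 * => IH u2v v0 uv0 d1.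
(* The right-hand side is the increment of [ln ^+ 2 + 2 * ln] from [N] to [N.+1], and [u - v] is at
   least [1 / (x + 1)]. *)
suff : (ln C + u) / x <= (u - v) * (u + v + 2) by nra.
rewrite ler_pdivrMr; last by lra.
have k1 : ln C + u <= x / (x + 1) * (u + v + 2).
  rewrite mulrAC ler_pdivlMr; last by lra.
  have : u <= x * v by nra.
  by nra.
apply: (le_trans k1).
have k2 : x / (x + 1) <= x * (u - v).
  rewrite ler_wpM2l //.
  rewrite -[_^-1]mul1r ler_pdivrMr; last by lra.
  by rewrite mulrC.
have : 0 <= u + v + 2 by lra.
move=> /ler_wpM2r/(_ _ _ k2)/le_trans; apply.
by rewrite le_eqVlt; apply/orP; left; apply/eqP; ring.
Qed.

(** In logarithmic form the block inequality bounds [2 * a j] by the mean over [j..k] plus a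
    constant, and [mean_le_last] bounds that mean by [2 * a k] plus a sum; [hkz_constant_le]
    estimates both contributions together. *)
Lemma hkz_ratio_le {R : realType} (C : R) (a : nat -> R) n :
  1 <= C -> C ^+ 2 <= 2 ->
  (forall j m, (j + m < n)%N -> expR (2 * a j) <=
    C * (m.+1%:R * expR (2 / m.+1%:R * \sum_(i < m.+1) a (j + i)%N))) ->
  forall j k, (j <= k)%N -> (k < n)%N ->
    2 * a j - 2 * a k <= ln n%:R ^+ 2 + 3 * ln n%:R.
Proof.
move=> C1 C2 ha j k jk kn; have C0 : 0 < C by apply: lt_le_trans C1.
have hb i m : (i + m < n)%N -> 2 * a i <= ln (C * m.+1%:R) +
    (\sum_(l < m.+1) (2 * a (i + l)%N)) / m.+1%:R.
  move=> im; have pm : 0 < m.+1%:R :> R by rewrite ltr0n.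
  rewrite -ler_expR expRD lnK; last by rewrite posrE mulr_gt0.
  apply: le_trans (ha _ _ im) _; rewrite mulrA ler_pM2l ?mulr_gt0 //.
  by rewrite -mulr_sumr mulrAC.
have lnn : 0 <= ln n%:R :> R by rewrite ln_ge0 // ler1n (leq_trans _ kn).
have [m kE] : exists m, k = (j + m)%N by exists (k - j)%N; rewrite subnKC.
rewrite {k jk}kE in kn *; case: m => [|m] in kn *.
  by rewrite addn0 subrr addr_ge0 ?sqr_ge0 ?mulr_ge0.
have h1 := hb _ _ kn.
have h2 := mean_le_last (L := fun m => ln (C * m%:R)) hb kn.
have h3 := hkz_constant_le m C1 C2.
have mn : ln m.+2%:R <= ln n%:R :> R.
  by rewrite ler_ln ?posrE ?ltr0n ?ler_nat; lia.
have m0 : 0 <= ln m.+2%:R :> R by rewrite ln_ge0 // ler1n.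
have : ln m.+2%:R ^+ 2 <= ln n%:R ^+ 2 :> R by rewrite lerXn2r ?nnegrE.
move: h1 h2 h3 => /=; set S := _ / m.+2%:R; set K := \sum_(i < m.+1) _.
by move: S K (ln (C * _)) => S K l; lra.
Qed.

(** * Reduction of unitriangular matrices *)

Lemma mulmx_entry_le {R : realType} {m n p}
    (A : 'M[R]_(m, n)) (B : 'M[R]_(n, p)) (a b : R) :
  (forall i j, `|A i j| <= a) -> (forall i j, `|B i j| <= b) ->
  forall i j, `|(A *m B) i j| <= n%:R * (a * b).
Proof.
move=> Aa Bb i j; rewrite mxE; apply: (le_trans (ler_norm_sum _ _ _)).
have -> : n%:R * (a * b) = \sum_(k < n) a * b by rewrite sumr_const card_ord mulr_natl.
by apply: ler_sum => k _; rewrite normrM ler_pM.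
Qed.

Lemma nearest_int {R : realType} (x : R) : exists k : int, `|x - k%:~R| <= 2^-1.
Proof.
exists (Num.floor (x + 2^-1)).
have /andP[] := floor_itv (x + 2^-1); rewrite intrD => h1 h2.
by rewrite ler_norml; apply/andP; split; lra.
Qed.

Lemma nearest_int_mx {R : realType} {m n} (A : 'M[R]_(m, n)) :
  exists X : 'M[int]_(m, n), forall i j, `|(toR X + A) i j| <= 2^-1.
Proof.
have /choice[f fP] := @nearest_int R.
exists (\matrix_(i, j) - f (A i j)) => i j.
by rewrite !mxE rmorphN addrC.
Qed.

(* Halving the dimension: once both diagonal blocks are reduced, the
   off-diagonal block is [Y W1] with [Y] reduced modulo 1, and the one of the
   inverse is then [- V2 Y]. *)
Lemma unitriangular_reduction {R : realType} k n (N : 'M[R]_n) : (n <= 2 ^ k)%N ->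
  is_trig_mx N -> (forall i, N i i = 1) ->
  exists (U : 'M[int]_n) (V : 'M[R]_n),
    [/\ U \in unitmx, (toR U *m N) *m V = 1%:M,
        is_trig_mx (toR U *m N) /\ is_trig_mx V,
        forall i j, `|(toR U *m N) i j| <= 2 ^+ 'C(k.-1, 2) &
        forall i j, `|V i j| <= 2 ^+ 'C(k.-1, 2)].
Proof.
elim: k n N => [|k IH] n N nk trN N1.
  have N1' : N = 1%:M.
    apply/matrixP => i j; have ij : i = j.
      by apply/val_inj => /=; have := ltn_ord i; have := ltn_ord j; lia.
    by rewrite ij N1 mxE eqxx.
  have I1 i j : `|(1%:M : 'M[R]_n) i j| <= 2 ^+ 'C(0.-1, 2).
    by rewrite mxE bin_small // expr0; case: eqP; rewrite ?normr1 ?normr0.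
  exists 1%:M, 1%:M; rewrite N1' map_mx1 !mulmx1; split=> //.
  exact: unitmx1.
have [p [q [pk qk nE]]] : exists p q, [/\ p <= 2 ^ k, q <= 2 ^ k & n = p + q]%N.
  by exists n./2, (uphalf n); move: nk; rewrite expnS; split; lia.
move: N trN N1; rewrite {n nk}nE => N trN N1.
have [i|U1 [V1 [uU1 WV1 [trW1 trV1] W1le V1le]]] :=
  IH p (ulsubmx N) pk (ulsubmx_trig trN).
  by rewrite !mxE.
have [i|U2 [V2 [uU2 WV2 [trW2 trV2] W2le V2le]]] :=
  IH q (drsubmx N) qk (drsubmx_trig (leqnn _) trN).
  by rewrite !mxE.
set W1 := toR U1 *m ulsubmx N in WV1 trW1 W1le.
set W2 := toR U2 *m drsubmx N in WV2 trW2 W2le.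
have VW1 : V1 *m W1 = 1%:M by apply: mulmx1C.
have [X Yle] := nearest_int_mx (toR U2 *m dlsubmx N *m V1).
set Y := toR X + _ in Yle.
have YW1 : toR (X *m U1) *m ulsubmx N + toR U2 *m dlsubmx N = Y *m W1.
  by rewrite mulmxDl -[in RHS]mulmxA VW1 mulmx1 map_mxM -mulmxA.
have WE : toR (block_mx U1 0 (X *m U1) U2) *m N = block_mx W1 0 (Y *m W1) W2.
  rewrite map_block_mx map_mx0 -[N]submxK (ursubmx_trig (leqnn _) trN) mulmx_block.
  by rewrite !mulmx0 !mul0mx !addr0 add0r -YW1.
pose M : R := 2 ^+ 'C(k.-1, 2); pose M' : R := 2 ^+ 'C(k, 2).
have MM' : M <= M' by rewrite /M /M' ler_weXn2l ?ler1n // leq_bin2l // leq_pred.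
have M1 : 1 <= M by rewrite exprn_ege1 // ler1n.
(* Each off-diagonal block is a product over an inner dimension at most [2 ^ k], with one factor
   bounded by 1/2. For [k > 0] this adds [k - 1] to the exponent, turning ['C(k.-1, 2)] into
   ['C(k, 2)]; for [k = 0] both binomials vanish. *)
have pM (r : nat) : (r <= 2 ^ k)%N -> r%:R * (2^-1 * M) <= M'.
  move=> rk; have rk' : r%:R <= 2 ^+ k :> R by rewrite -natrX ler_nat.
  apply: (@le_trans _ _ (2 ^+ k * (2^-1 * M))).
    by rewrite ler_pM2r // mulr_gt0 ?invr_gt0 // (lt_le_trans ltr01).
  rewrite /M' /M; case: k {IH pk qk W1le V1le W2le V2le M M' MM' M1 rk rk'} => [|k] /=.
    by rewrite !bin_small // !expr0; lra.
  rewrite binS bin1 exprD [X in X * _]exprS.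
  by rewrite le_eqVlt; apply/orP; left; apply/eqP; field.
exists (block_mx U1 0 (X *m U1) U2), (block_mx V1 0 (- (V2 *m Y)) V2).
rewrite WE; split.
- by rewrite unitmxE det_lblock unitrM -!unitmxE uU1.
- rewrite mulmx_block !mulmx0 !mul0mx !addr0 add0r WV1 WV2 mulmxN (mulmxA W2) WV2 mul1mx.
  by rewrite -mulmxA WV1 mulmx1 subrr -scalar_mx_block.
- by rewrite !is_trig_block_mx // eqxx trW1 trW2 trV1 trV2.
- move=> i j; rewrite -/M'.
  case: (split_ordP i) => {}i ->; case: (split_ordP j) => {}j ->.
  + by rewrite block_mxEul (le_trans (W1le _ _)).
  + by rewrite block_mxEur mxE normr0 (le_trans _ MM') // (le_trans _ M1).
  + rewrite block_mxEdl; apply: le_trans (pM _ pk); exact: mulmx_entry_le.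
  + by rewrite block_mxEdr (le_trans (W2le _ _)).
- move=> i j; rewrite -/M'.
  case: (split_ordP i) => {}i ->; case: (split_ordP j) => {}j ->.
  + by rewrite block_mxEul (le_trans (V1le _ _)).
  + by rewrite block_mxEur mxE normr0 (le_trans _ MM') // (le_trans _ M1).
  + rewrite block_mxEdl mxE normrN; apply: le_trans (pM _ qk).
    by rewrite [2^-1 * M]mulrC; exact: mulmx_entry_le.
  + by rewrite block_mxEdr (le_trans (V2le _ _)).
Qed.

(** * Estimate of the Seysen measure *)

(** The basis has entries [W i j * expR (a j)] and its dual [V k i * expR (- a k)]. Triangularity
    leaves the products with [j <= i <= k], a range in which [arho] bounds the exponent. *)
Lemma seysen_le {R : realType} {n} (W V : 'M[R]_n) (a : 'I_n -> R) (M rho : R) :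
  W *m V = 1%:M -> is_trig_mx W -> is_trig_mx V ->
  (forall i j, `|W i j| <= M) -> (forall i j, `|V i j| <= M) ->
  (forall j k : 'I_n, (j <= k)%N -> 2 * a j - 2 * a k <= rho) ->
  seysen (W *m diag_mx (\row_j expR (a j))) <= n%:R ^+ 3 * (M ^+ 4 * expR rho).
Proof.
move=> WV /is_trig_mxP trW /is_trig_mxP trV WM VM arho.
set D := diag_mx _; pose D' : 'M[R]_n := diag_mx (\row_j expR (- a j)).
have DD' : D *m D' = 1%:M.
  rewrite mulmx_diag -diag_const_mx; congr diag_mx.
  by apply/rowP => j; rewrite !mxE -expRD subrr expR0.
have iWD : invmx (W *m D) = D' *m V.
  by apply: invmx_eq; rewrite mulmxA -(mulmxA W) DD' mulmx1.
have WDE i : enorm (row i (W *m D)) ^+ 2 = \sum_j W i j ^+ 2 * expR (2 * a j).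
  rewrite enorm_sqr; apply: eq_bigr => j _.
  by rewrite mxE mul_mx_diag !mxE exprMn expRM_natl.
have VDE i : enorm (row i (dual_basis (W *m D))) ^+ 2 =
    \sum_k V k i ^+ 2 * expR (- (2 * a k)).
  rewrite enorm_sqr; apply: eq_bigr => j _.
  by rewrite mxE /dual_basis iWD mxE mul_diag_mx !mxE exprMn mulrC -mulrN expRM_natl.
have M0 (i : 'I_n) : 0 <= M by apply: le_trans (WM i i).
have sqle (x : R) : `|x| <= M -> x ^+ 2 <= M ^+ 2.
  by move=> xM; rewrite -real_normK ?num_real // lerXn2r ?nnegrE // (le_trans _ xM).
have -> : n%:R ^+ 3 * (M ^+ 4 * expR rho) =
    \sum_(i < n) \sum_(j < n) \sum_(k < n) (M ^+ 4 * expR rho).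
  by rewrite !(sumr_const, card_ord) -!mulrnA -[RHS]mulr_natr !natrM; ring.
apply: ler_sum => i _; rewrite WDE VDE mulr_suml; apply: ler_sum => j _.
rewrite mulr_sumr; apply: ler_sum => k _.
have rhs0 : 0 <= M ^+ 4 * expR rho by rewrite mulr_ge0 ?expR_ge0 // exprn_ge0 // M0.
have [ij|ji] := ltnP i j; first by rewrite trW // expr0n /= !mul0r.
have [ki|ik] := ltnP k i; first by rewrite trV // expr0n /= mul0r mulr0.
have -> : W i j ^+ 2 * expR (2 * a j) * (V k i ^+ 2 * expR (- (2 * a k))) =
    W i j ^+ 2 * V k i ^+ 2 * expR (2 * a j - 2 * a k) by rewrite expRD; ring.
have -> : M ^+ 4 = M ^+ 2 * M ^+ 2 by ring.
apply: ler_pM; rewrite ?expR_ge0 //; first by rewrite mulr_ge0 ?sqr_ge0.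
  by apply: ler_pM; rewrite ?sqr_ge0 ?sqle.
by rewrite ler_expR; exact/arho/(leq_trans ji ik).
Qed.

(** For [n >= 2] and [q = (up_log 2 n).-1] one has [2 ^ q < n], hence [q * ln 2 <= ln n]. In
    [4 'C(q, 2) = 2 q (q - 1)] the [- 1] accounts for the gain [- 2 * ln n]. *)
Lemma reduction_constant_le {R : realType} n : (0 < n)%N ->
  (2 ^+ 'C((up_log 2 n).-1, 2) : R) ^+ 4 <=
  expR (2 / ln 2 * ln n%:R ^+ 2 - 2 * ln n%:R).
Proof.
move=> n0; have [n1|n2] := leqP n 1.
  have -> : n = 1%N by lia.
  by rewrite up_log1 ln1 !mulr0 expr0n mulr0 subr0 expR0 !expr1n.
set q := (up_log 2 n).-1.
have l0 : 0 < ln 2 :> R by rewrite ln_gt0 // ltr1n.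
have lnl : ln 2 <= ln n%:R :> R by rewrite ler_ln ?posrE ?ltr0n ?ler_nat.
have qln : q%:R * ln 2 <= ln n%:R :> R.
  rewrite mulr_natl -lnXn // ler_ln ?posrE ?exprn_gt0 ?ltr0n // -natrX ler_nat.
  exact/ltnW/up_log_gtn.
have binE : 'C(q, 2)%:R * 2 = q%:R * (q%:R - 1) :> R.
  elim: q {qln} => [|q IH]; first by rewrite bin_small // !mul0r.
  by rewrite binS bin1 natrD mulrDl IH -natr1; ring.
rewrite -exprM -[X in X ^+ _](@lnK R) ?posrE // -expRM_natl ler_expR natrM.
set b := _%:R in binE *; set x := ln n%:R in lnl qln *; set l := ln 2 in l0 lnl qln *.
have -> : 2 / l * x ^+ 2 - 2 * x = 2 * (x * (x - l)) / l by field; rewrite gt_eqF.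
rewrite ler_pdivlMr //.
have : q%:R * l * ((q%:R - 1) * l) <= x * (x - l).
  (* For [q = 0] the factor [q%:R - 1] is negative, so factors cannot be compared one by one. *)
  case: q qln {binE b} => [|q] qln; first by rewrite !mul0r mulr_ge0 //; lra.
  move: qln; rewrite -natr1 addrK => qln.
  have q0 : 0 <= q%:R :> R by rewrite ler0n.
  by apply: ler_pM; nra.
have -> : b * 4 * l * l = 2 * (q%:R * l * ((q%:R - 1) * l)).
  have -> : b * 4 * l * l = 2 * (b * 2) * l * l by ring.
  by rewrite binE; ring.
by rewrite ler_pM2l.
Qed.

Theorem proposition2p2 (R : realType) (n : nat) (hn : (1 <= n)%N)
    (L : set 'rV[R]_n) (hL : is_lattice L) :
  exists B : 'M[R]_n, lattice_basis L B /\
    seysen B <= expR ((2 / ln 2 + 1) * ln (n%:R : R) ^+ 2 + 4 * ln (n%:R : R)).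
Proof.
have [B0 [fB0 ->]] := hL; have uB0 : B0 \in unitmx by rewrite -row_free_unit.
(* Both slack factors are [t], so the constant [C] is [t ^+ 3], and its square, about 1.77, stays
   below 2. *)
pose t : R := 11 / 10; have t1 : 1 < t by rewrite /t; lra.
have [U [Q [a [uU QQ trT Ta Tle]]]] := almost_hkz t1 t1 uB0.
have ratio : forall j k : 'I_n, (j <= k)%N ->
    2 * a j - 2 * a k <= ln n%:R ^+ 2 + 3 * ln n%:R.
  move=> j k jk; apply: (@hkz_ratio_le R (t ^+ 3) a n) => //; rewrite /t; try lra.
  by move=> i m im; apply: le_trans (Tle i m im) _; rewrite exprS -!mulrA.
set T := toR U *m B0 *m Q in trT Ta.
(* Splitting off the diagonal on the right lets integer row operations act on the unitriangular
   factor alone. *)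
pose D : 'M[R]_n := diag_mx (\row_j expR (a j)).
pose N : 'M[R]_n := \matrix_(i, j) (T i j / expR (a j)).
have ND : T = N *m D.
  by apply/matrixP => i j; rewrite mul_mx_diag !mxE divfK // gt_eqF // expR_gt0.
have trN : is_trig_mx N.
  by apply/is_trig_mxP => i j ij; rewrite mxE (is_trig_mxP trT) // mul0r.
have N1 i : N i i = 1 by rewrite mxE Ta divff // gt_eqF // expR_gt0.
have [U' [V [uU' WV [trW trV] Wle Vle]]] :=
  unitriangular_reduction (up_logP n (isT : (1 < 2)%N)) trN N1.
exists (toR (U' *m U) *m B0); split.
  split; last by rewrite zspan_unimodular // unitmx_mul uU'.
  by rewrite row_free_unit unitmx_mul uB0 toR_unitmx // unitmx_mul uU'.
rewrite -(seysen_orth _ QQ); last first.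
  by rewrite unitmx_mul uB0 toR_unitmx // unitmx_mul uU'.
have -> : toR (U' *m U) *m B0 *m Q = toR U' *m N *m D.
  by rewrite map_mxM -[RHS]mulmxA -ND /T !mulmxA.
apply: le_trans (seysen_le WV trW trV Wle Vle ratio) _.
have n3 : n%:R ^+ 3 = expR (3 * ln n%:R) :> R.
  by rewrite expRM_natl lnK // posrE ltr0n.
(* The coefficients of [ln n] add up to [3 - 2 + 3 = 4]. *)
rewrite n3; apply: (@le_trans _ _ (expR (3 * ln n%:R) *
    (expR (2 / ln 2 * ln n%:R ^+ 2 - 2 * ln n%:R) * expR (ln n%:R ^+ 2 + 3 * ln n%:R)))).
  by rewrite ler_pM2l ?expR_gt0 // ler_pM2r ?expR_gt0 // reduction_constant_le.
by rewrite -!expRD ler_expR le_eqVlt; apply/orP; left; apply/eqP; ring.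
Qed.
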